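(* For any $k\in\mathbb N$, there exist pairs of locally homogeneous Riemannian manifolds which are not curvature equivalent, but do not differ in any curvature invariant of order up to $2k$.
   Context: Two locally homogeneous Riemannian manifolds $(M,g)$, $(M',g')$ are called curvature equivalent (of order zero) if for $p\in M$, $p'\in M'$ there exists a euclidean isometry $F:(T_pM,g_p)\to(T_{p'}M',g'_{p'})$ which intertwines the Riemannian curvature operators, that is, $F(R(X,Y)Z)=R(F(X),F(Y))F(Z)$ for all $X,Y,Z\in T_pM$. A curvature invariant is a polynomial in the coefficients of the Riemannian curvature tensor $R$ and its covariant derivatives $\nabla R,\nabla^2R,\dots$, taken with respect to an orthonormal basis of the tangent space at the point under consideration, which is invariant under changes of the orthonormal basis. It has order $k$ if it is a sum of terms each involving a total of $k$ derivatives of the metric, where each occurrence of $R$ (or its contractions) counts as two and each occurrence of $\nabla$ adds one. On a locally homogeneous manifold each curvature invariant is a constant function; two such manifolds ''differ'' in it if these constants are different. (A comparison of curvature invariants is understood for manifolds of the same dimension.) *)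

(* Defs.v *)
(* The real numbers are an arbitrary R : realType. *)
From HB Require Import structures.
From mathcomp Require Export all_boot all_order all_algebra.
From mathcomp Require Export all_classical all_reals all_analysis.

Set Implicit Arguments.
Unset Strict Implicit.
Unset Printing Implicit Defensive.

Import Order.TTheory GRing.Theory Num.Theory.
Import numFieldNormedType.Exports.

Local Open Scope classical_set_scope.
Local Open Scope ring_scope.

Definition partial (R : realType) (n : nat) (W : normedModType R)
    (i : 'I_n) (f : 'rV[R]_n -> W) : 'rV[R]_n -> W :=
  'D_(delta_mx 0 i) f.

(* f is of class C^r on the open set A *)
Fixpoint class_C (R : realType) (n : nat) (W : normedModType R) (r : nat)
    (A : set 'rV[R]_n) (f : 'rV[R]_n -> W) : Prop :=
  (forall x, A x -> {for x, continuous f}) /\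
  if r is r'.+1 then
    forall i : 'I_n, (forall x, A x -> derivable f x (delta_mx 0 i)) /\
                     class_C r' A (partial i f)
  else True.

Definition smooth_on (R : realType) (n : nat) (W : normedModType R)
    (A : set 'rV[R]_n) (f : 'rV[R]_n -> W) : Prop :=
  forall r, class_C r A f.

(* A homeomorphism between an open subset of T and an open subset of R^n;
   the values of chart_fun and chart_inv outside these sets are irrelevant. *)
Record chart (R : realType) (n : nat) (T : topologicalType) := Chart {
  chart_dom : set T;
  chart_img : set 'rV[R]_n;
  chart_fun : T -> 'rV[R]_n;
  chart_inv : 'rV[R]_n -> T;
  open_chart_dom : open chart_dom;
  open_chart_img : open chart_img;
  chart_fun_img : forall p, chart_dom p -> chart_img (chart_fun p);
  chart_inv_dom : forall x, chart_img x -> chart_dom (chart_inv x);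
  chart_funK : forall p, chart_dom p -> chart_inv (chart_fun p) = p;
  chart_invK : forall x, chart_img x -> chart_fun (chart_inv x) = x;
  chart_fun_continuous :
    forall p, chart_dom p -> {for p, continuous chart_fun};
  chart_inv_continuous :
    forall x, chart_img x -> {for x, continuous chart_inv}
}.

Definition transition (R : realType) (n : nat) (T : topologicalType)
    (c d : chart R n T) : 'rV[R]_n -> 'rV[R]_n :=
  chart_fun d \o chart_inv c.

Definition overlap (R : realType) (n : nat) (T : topologicalType)
    (c d : chart R n T) : set 'rV[R]_n :=
  [set x | chart_img c x /\ chart_dom d (chart_inv c x)].

(* The preferred chart chart_at p identifies the tangent space at p with R^n;
   it carries no geometric information. *)
Record manifold (R : realType) (n : nat) := Manifold {
  carrier :> topologicalType;
  manifold_hausdorff : hausdorff_space carrier;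
  manifold_second_countable : @second_countable carrier;
  manifold_nonempty : [set: carrier] !=set0;
  atlas : set (chart R n carrier);
  chart_at : carrier -> chart R n carrier;
  chart_at_atlas : forall p, atlas (chart_at p);
  chart_at_dom : forall p, chart_dom (chart_at p) p;
  transition_smooth : forall c d, atlas c -> atlas d ->
    smooth_on (overlap c d) (transition c d)
}.

(* metric c x is the matrix (g(d_a, d_b))_(a, b) in the chart c, at the point
   with coordinates x.  Vectors are rows and a linear map acts on them by
   right multiplication, so the differential of f at x is v |-> v *m 'J f x
   and a form g pulls back to J *m g *m J^T. *)
Record riemannian (R : realType) (n : nat) := Riemannian {
  underlying :> manifold R n;
  metric : chart R n underlying -> 'rV[R]_n -> 'M[R]_n;
  metric_smooth : forall c, atlas c -> smooth_on (chart_img c) (metric c);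
  metric_sym : forall c x, atlas c -> chart_img c x ->
    (metric c x)^T = metric c x;
  metric_pos : forall c x (v : 'rV[R]_n), atlas c -> chart_img c x ->
    v != 0 -> 0 < (v *m metric c x *m v^T) 0 0;
  metric_compat : forall c d x, atlas c -> atlas d -> overlap c d x ->
    metric c x = jacobian (transition c d) x *m
                   metric d (transition c d x) *m
                 (jacobian (transition c d) x)^T
}.

Section LocalIsometries.
Variables (R : realType) (n : nat).

Definition local_expr (M N : manifold R n) (f : M -> N)
    (c : chart R n M) (d : chart R n N) : 'rV[R]_n -> 'rV[R]_n :=
  chart_fun d \o f \o chart_inv c.

Definition local_expr_dom (M N : manifold R n) (U : set M) (f : M -> N)
    (c : chart R n M) (d : chart R n N) : set 'rV[R]_n :=
  [set x | [/\ chart_img c x, U (chart_inv c x) &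
               chart_dom d (f (chart_inv c x))]].

Definition smooth_map_on (M N : manifold R n) (U : set M) (f : M -> N) :
    Prop :=
  (forall p, U p -> {for p, continuous f}) /\
  forall c d, atlas c -> atlas d ->
    smooth_on (local_expr_dom U f c d) (local_expr f c d).

Definition preserves_metric_on (M N : riemannian R n) (U : set M)
    (f : M -> N) : Prop :=
  forall c d x, atlas c -> atlas d -> local_expr_dom U f c d x ->
    metric c x = jacobian (local_expr f c d) x *m
                   metric d (local_expr f c d x) *m
                 (jacobian (local_expr f c d) x)^T.

(* f restricts to an isometry from U onto V, with inverse h *)
Definition isometry_between (M N : riemannian R n) (U : set M) (V : set N)
    (f : M -> N) (h : N -> M) : Prop :=
  [/\ open U /\ open V,
      (forall p, U p -> V (f p) /\ h (f p) = p) /\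
      (forall q, V q -> U (h q) /\ f (h q) = q),
      smooth_map_on U f /\ smooth_map_on V h &
      preserves_metric_on U f].

Definition locally_homogeneous (M : riemannian R n) : Prop :=
  forall p q : M, exists (U V : set M) (f h : M -> M),
    [/\ U p, V q, f p = q & isometry_between U V f h].

End LocalIsometries.

Section CoordinateCurvature.
Variables (R : realType) (n : nat) (G : 'rV[R]_n -> 'M[R]_n).

(* Gamma^c_(a b) *)
Definition christoffel (c a b : 'I_n) (x : 'rV[R]_n) : R :=
  2^-1 * \sum_(d < n) invmx (G x) c d *
    (partial a (fun y => G y b d) x + partial b (fun y => G y a d) x
     - partial d (fun y => G y a b) x).

(* the coefficient of d_d in R(d_a, d_b) d_c, where
   R(X, Y) = [nabla_X, nabla_Y] - nabla_[X, Y] *)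
Definition riem (a b c d : 'I_n) (x : 'rV[R]_n) : R :=
  partial a (christoffel d b c) x - partial b (christoffel d a c) x
  + \sum_(e < n) (christoffel d a e x * christoffel e b c x
                  - christoffel d b e x * christoffel e a c x).

(* components of a covariant tensor field of rank r in the coordinate frame *)
Definition tensor_field (r : nat) := r.-tuple 'I_n -> 'rV[R]_n -> R.

(* g(R(d_a, d_b) d_c, d_d) for t = (a, b, c, d) *)
Definition riem_tensor : tensor_field 4 := fun t x =>
  \sum_(e < n) riem (tnth t (inord 0)) (tnth t (inord 1))
                    (tnth t (inord 2)) e x * G x e (tnth t (inord 3)).

(* the direction of differentiation is the first index *)
Definition cov_deriv (r : nat) (T : tensor_field r) : tensor_field r.+1 :=
  fun t x =>
    let a := thead t in
    let b : r.-tuple 'I_n := behead_tuple t in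
    partial a (T b) x
    - \sum_(s < r) \sum_(e < n) christoffel e a (tnth b s) x *
        T [tuple if u == s then e else tnth b u | u < r] x.

Fixpoint iter_cov_deriv_riem (m : nat) : tensor_field (m + 4) :=
  match m return tensor_field (m + 4) with
  | 0 => riem_tensor
  | m'.+1 => cov_deriv (@iter_cov_deriv_riem m')
  end.

End CoordinateCurvature.

Arguments iter_cov_deriv_riem {R n} G m t x.

(* T_p M is identified with R^n, and the inner product, the curvature operator
   and the tensors nabla^m R at p are computed, in the chart chart_at p. *)
Section PointwiseCurvature.
Variables (R : realType) (n : nat) (M : riemannian R n) (p : M).

Let G := metric (chart_at p).
Let x := chart_fun (chart_at p) p.

Definition inner (u v : 'rV[R]_n) : R := (u *m G x *m v^T) 0 0.

Definition curvature_op (X Y Z : 'rV[R]_n) : 'rV[R]_n :=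
  \row_(d < n) \sum_(a < n) \sum_(b < n) \sum_(c < n)
    X 0 a * Y 0 b * Z 0 c * riem G a b c d x.

(* the rows of E form an orthonormal basis of T_p M *)
Definition orthonormal (E : 'M[R]_n) : Prop :=
  forall i j : 'I_n, inner (row i E) (row j E) = (i == j)%:R.

(* (nabla^m R)(E_(t_1), ..., E_(t_(m+4))) *)
Definition frame_coef (E : 'M[R]_n) (m : nat) (t : (m + 4).-tuple 'I_n) : R :=
  \sum_(s : (m + 4).-tuple 'I_n)
    (\prod_(u < m + 4) E (tnth t u) (tnth s u))
    * iter_cov_deriv_riem G m s x.

End PointwiseCurvature.

Definition curvature_equivalent (R : realType) (n n' : nat)
    (M : riemannian R n) (M' : riemannian R n') : Prop :=
  forall (p : M) (p' : M'), exists F : {linear 'rV[R]_n -> 'rV[R]_n'},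
    [/\ bijective F,
        forall X Y, inner p' (F X) (F Y) = inner p X Y &
        forall X Y Z, F (curvature_op p X Y Z)
                      = curvature_op p' (F X) (F Y) (F Z)].

(* The variable (m, t) stands for the coefficient of nabla^m R with indices t
   in an orthonormal basis.  A polynomial in these (infinitely many) variables
   is given as a list of terms (coefficient, list of factors). *)
Definition curv_var (n : nat) : Type := {m : nat & (m + 4).-tuple 'I_n}.

Definition curv_poly (R : realType) (n : nat) : Type :=
  seq (R * seq (curv_var n)).

Definition eval_curv_poly (R : realType) (n : nat) (P : curv_poly R n)
    (M : riemannian R n) (p : M) (E : 'M[R]_n) : R :=
  \sum_(term <- P) term.1 *
    \prod_(v <- term.2) frame_coef p E (tagged v).

Definition curvature_invariant (R : realType) (n : nat) (P : curv_poly R n) :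
    Prop :=
  forall (M : riemannian R n) (p : M) (E E' : 'M[R]_n),
    orthonormal p E -> orthonormal p E' ->
    eval_curv_poly P p E = eval_curv_poly P p E'.

(* an occurrence of nabla^m R involves m + 2 derivatives of the metric *)
Definition has_order (R : realType) (n : nat) (P : curv_poly R n) (k : nat) :
    Prop :=
  forall term, term \in P -> (\sum_(v <- term.2) (tag v + 2))%N = k.

(* P is constant, with value a, on M *)
Definition constant_value (R : realType) (n : nat) (P : curv_poly R n)
    (M : riemannian R n) (a : R) : Prop :=
  forall (p : M) (E : 'M[R]_n), orthonormal p E -> eval_curv_poly P p E = a.

Definition same_constant (R : realType) (n : nat) (P : curv_poly R n)
    (M M' : riemannian R n) : Prop :=
  exists a : R, constant_value P M a /\ constant_value P M' a.

(* Main.v *)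
Require Import Defs.
From mathcomp Require Import all_fingroup.
From mathcomp Require Import ring lra.

(** Consider a product of m surfaces of constant curvatures k_1, ..., k_m.  It
    is a symmetric space, so the covariant derivatives of its curvature tensor
    vanish, and in a frame adapted to the factors the entries of R itself are
    linear in the k_i.  A curvature invariant of order j therefore takes on it
    a value which is a homogeneous polynomial of degree j / 2 in k_1, ..., k_m,
    and this polynomial is symmetric, because permuting the factors permutes
    the vectors of an adapted orthonormal frame.  A symmetric polynomial of
    degree at most k depends only on the power sums of degree at most k.  So it
    is enough to find two families of curvatures with the same power sums up to
    degree k, all nonpositive, one of which has a curvature lower than all those of
    the other: sectional curvatures are preserved by a curvature equivalence,
    and on a product of such surfaces they are at least the lowest curvature of
    the factors.

    Such families are given by the solutions of Prouhet of the Tarry-Escott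
    problem: A_(r+1) = A_r ++ (B_r + 1) and B_(r+1) = B_r ++ (A_r + 1), starting
    with A_0 = [0] and B_0 = [].  The difference of the sums of f over A_r and
    B_r is, up to sign, the r-th finite difference of f at 0, hence it vanishes
    on powers of exponent less than r ([prouhet_power_sums]); and r itself is an
    entry of only one of the two lists, and the largest ([prouhet_max]).  The
    curvatures are the opposites of these integers.

    The factors are hyperbolic planes (or flat ones, for curvature 0), in
    coordinates (t, x) in which the metric is dt^2 + exp(2 c t) dx^2 with
    curvature - c^2.  In these coordinates the product is a diagonal metric on
    all of R^n, so that one chart suffices, and affine maps act transitively by
    isometries, so that homogeneity is elementary ([hyp_product_homogeneous]).
    The Christoffel symbols, the curvature tensor and its parallelism are then
    computed ([hyp_christoffel], [hyp_riem], [cov_deriv_hyp]).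

    The reduction to power sums averages over all permutations of the factors:
    by induction on the number of distinct variables of a monomial, the sum of
    its images under the symmetric group is determined by the power sums
    ([eq_sum_perm_prod]).  This yields [same_constant_plane_product], while
    [not_curvature_equivalent_plane_product] rests on the bound
    [sectional_form_bound] of sectional curvatures. *)

Set Implicit Arguments.
Unset Strict Implicit.
Unset Printing Implicit Defensive.

Import Order.TTheory GRing.Theory Num.Theory.
Import numFieldNormedType.Exports.

Local Open Scope ring_scope.

(** * Multisets of integers with equal power sums *)

Fixpoint prouhet (r : nat) : seq nat * seq nat :=
  if r is r'.+1 then
    let: (A, B) := prouhet r' in (A ++ map S B, B ++ map S A)
  else ([:: 0%N], [::]).

(** Going from r to r.+1 replaces the functional D f, the difference of the sums
    of f over the two lists, by D (f - f (_ + 1)).  By the binomial formula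
    x ^ d - (x + 1) ^ d is a combination of lower powers of x, on which D
    already vanishes. *)
Lemma prouhet_power_sums (R : comNzRingType) r d : (d < r)%N ->
  \sum_(x <- (prouhet r).1) x%:R ^+ d
    = \sum_(x <- (prouhet r).2) x%:R ^+ d :> R.
Proof.
move=> ltdr; apply/eqP; rewrite -subr_eq0; apply/eqP; move: ltdr.
elim: r d => // r IH d; rewrite ltnS => ledr.
move: IH; rewrite /=; case: (prouhet r) => A B /= IH.
pose D (f : nat -> R) := \sum_(x <- A) f x - \sum_(x <- B) f x.
have DS : D (fun x => x.+1%:R ^+ d) =
    \sum_(i < d.+1) D (fun x => x%:R ^+ i) *+ 'C(d, i).
  have E (x : nat) : x.+1%:R ^+ d = \sum_(i < d.+1) x%:R ^+ i *+ 'C(d, i) :> R.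
    rewrite -natr1 addrC exprDn; apply: eq_bigr => i _.
    by rewrite expr1n mul1r.
  rewrite /D; under eq_bigr do rewrite E.
  under [X in _ - X]eq_bigr do rewrite E.
  rewrite exchange_big [X in _ - X]exchange_big /= -sumrB.
  by apply: eq_bigr => i _; rewrite !sumrMnl mulrnBl.
have {DS} DS : D (fun x => x.+1%:R ^+ d) = D (fun x => x%:R ^+ d).
  rewrite DS big_ord_recr /= binn mulr1n big1 ?add0r // => i _.
  by rewrite /D IH ?mul0rn // (leq_trans _ ledr).
rewrite !big_cat !big_map /= opprD addrACA.
rewrite -[X in _ + X]opprB -/(D (fun x => x%:R ^+ d)).
by rewrite -/(D (fun x => x.+1%:R ^+ d)) DS subrr.
Qed.

(** The bound on the list that contains r is what makes the induction work: it
    ensures that r.+1 is new in the other list. *)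
Lemma prouhet_max r (P := prouhet r) (lt := all (fun x => x < r)%N) :
  [/\ r \in P.1, lt P.2 & all (fun x => x <= r)%N P.1] \/
  [/\ r \in P.2, lt P.1 & all (fun x => x <= r)%N P.2].
Proof.
rewrite {}/P {}/lt; elim: r => [|r]; first by left.
rewrite /=; case: (prouhet r) => A B /= IH.
have ltS X : all (fun x => x < r)%N X -> all (fun x => x < r.+1)%N X.
  by apply: sub_all => x /ltnW.
have ltW X : all (fun x => x < r)%N X -> all (fun x => x <= r.+1)%N X.
  by apply: sub_all => x /ltnW /leqW.
have leW X : all (fun x => x <= r)%N X -> all (fun x => x <= r.+1)%N X.
  by apply: sub_all => x /leqW.
case: IH => -[rA ltB leA]; [right|left].
all: rewrite !mem_cat !all_cat !all_map (map_f S rA) orbT; split=> //.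
all: by apply/andP; split; rewrite ?ltW ?leW ?leA ?ltS.
Qed.

Lemma prouhet_tarry_escott (R : numDomainType) k :
  exists (m : nat) (x y : 'I_m -> nat),
    (forall d, (d <= k)%N ->
       \sum_i (x i)%:R ^+ d = \sum_i (y i)%:R ^+ d :> R) /\
    exists i0, forall j, (y j < x i0)%N.
Proof.
have [A [B [E [r [rA /allP ltB]]]]] : exists A B : seq nat,
    (forall d, (d <= k)%N ->
       \sum_(x <- A) x%:R ^+ d = \sum_(x <- B) x%:R ^+ d :> R) /\
    exists r, r \in A /\ all (fun x => x < r)%N B.
  have E d : (d <= k)%N -> _ := @prouhet_power_sums R k.+1 d.
  case: (prouhet_max k.+1) => -[mem lt _].
    by exists (prouhet k.+1).1, (prouhet k.+1).2; split=> //; exists k.+1.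
  exists (prouhet k.+1).2, (prouhet k.+1).1; split=> [d led|]; first by rewrite E.
  by exists k.+1.
(* The exponent d = 0 says that the two lists are equally long. *)
have eqs : size A = size B.
  have := E 0 (leq0n k); under eq_bigr do rewrite expr0.
  under [RHS]eq_bigr do rewrite expr0.
  rewrite !big_const_seq !count_predT !iter_addr_0 => /eqP.
  by rewrite eqr_nat => /eqP.
exists (size A), (fun i => nth 0%N A i), (fun i => nth 0%N B i); split.
  move=> d led; have := E d led.
  by rewrite (big_nth 0%N) big_mkord [X in _ = X -> _](big_nth 0%N) big_mkord -eqs.
have lti : (index r A < size A)%N by rewrite index_mem.
exists (Ordinal lti) => j /=; rewrite nth_index //.
by apply: ltB; rewrite mem_nth // -eqs.
Qed.

Section Symmetrization.
Variables (R : numDomainType) (I : finType) (k : nat) (x y : I -> R).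
Hypothesis eq_power_sums :
  forall d, (d <= k)%N -> \sum_i x i ^+ d = \sum_i y i ^+ d.

Let sym (z : I -> R) (a : I -> nat) : R :=
  \sum_(s : {perm I}) \prod_i z (s i) ^+ a i.

(** Multiplying a monomial by a power sum distributes the exponent e over all
    variables; relabelling them by s makes this compatible with symmetrization. *)
Lemma sym_power_sum z a e :
  sym z a * \sum_i z i ^+ e
    = \sum_j sym z (fun i => a i + e * (i == j))%N.
Proof.
rewrite /sym exchange_big mulr_suml; apply: eq_bigr => s _.
rewrite [X in _ * X](reindex_inj (@perm_inj _ s)) mulr_sumr; apply: eq_bigr => j _.
under [RHS]eq_bigr do rewrite exprD; rewrite big_split /=; congr (_ * _).
rewrite (bigD1 j) //= eqxx muln1 big1 ?mulr1 // => i /negPf->.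
by rewrite muln0.
Qed.

Lemma sym_tperm z a i j : sym z (a \o tperm i j) = sym z a.
Proof.
rewrite /sym (reindex_inj (mulgI (tperm i j))); apply: eq_bigr => s _.
rewrite (reindex_inj (@perm_inj _ (tperm i j))) /=; apply: eq_bigr => l _.
by rewrite permM tpermK.
Qed.

(** Induction on the number of variables that occur in the monomial.  Remove a
    variable i0 of exponent e, and multiply the symmetrization of the rest a' by
    the power sum of degree e.  In the result, the terms where e lands on a
    variable of a' involve fewer variables, and all others are conjugate to a
    under a transposition, so they are copies of the symmetrization of a. *)
Lemma eq_symmetrization a : (\sum_i a i <= k)%N -> sym x a = sym y a.
Proof.
have [n] := ubnP #|[set i | a i != 0%N]|; elim: n a => // n IH a ltn lek.
have [i0 ai0|a0] := pickP (fun i => a i != 0%N); last first.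
  rewrite /sym; apply: eq_bigr => s _; apply: eq_bigr => i _.
  by move: (a0 i) => /negbFE/eqP->.
pose e := a i0; pose a' i := if i == i0 then 0%N else a i.
pose b j i := (a' i + e * (i == j))%N.
have sumaE : (\sum_i a i = e + \sum_i a' i)%N.
  rewrite (bigD1 i0) //=; congr (_ + _)%N.
  rewrite [RHS](bigD1 i0) //= {1}/a' eqxx add0n; apply: eq_bigr => i ni.
  by rewrite /a' (negPf ni).
have sub_a' : [set i | a' i != 0%N] \proper [set i | a i != 0%N].
  apply/properP; split; last by exists i0; rewrite inE // /a' eqxx.
  by apply/fintype.subsetP => i; rewrite !inE /a'; case: ifP.
have lt_a' : (#|[set i | a' i != 0]| < n)%N.
  by rewrite (leq_trans (proper_card sub_a')).
have IHa' : sym x a' = sym y a'.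
  by apply: IH => //; rewrite (leq_trans _ lek) // sumaE leq_addl.
have IHb j : a' j != 0%N -> sym x (b j) = sym y (b j).
  move=> a'j; apply: IH.
    rewrite (leq_trans _ lt_a') // ltnS; apply: subset_leq_card.
    apply/fintype.subsetP => i; rewrite !inE /b; apply: contraNN => /eqP a'i.
    case: (i =P j) => [eij|]; first by rewrite -eij a'i in a'j.
    by rewrite a'i muln0.
  rewrite (leq_trans _ lek) // sumaE addnC /b big_split leq_add2l /=.
  rewrite (bigD1 j) //= eqxx muln1 big1 ?addn0 // => i /negPf->.
  by rewrite muln0.
have b0 z j : a' j = 0%N -> sym z (b j) = sym z a.
  move=> a'j; rewrite -(sym_tperm z (b j) i0 j).
  rewrite /sym; apply: eq_bigr => s _; apply: eq_bigr => i _; congr (_ ^+ _).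
  rewrite /= /b; case: tpermP => [->|->|/eqP n0 /eqP nj]; last first.
  - by rewrite (negPf nj) muln0 addn0 /a' (negPf n0).
  - rewrite {1}/a' eqxx add0n; case: (i0 =P j) => [<-|/eqP n0]; first by rewrite muln1.
    by rewrite muln0 -a'j /a' eq_sym (negPf n0).
  - by rewrite a'j eqxx muln1.
have main z : #|[pred j | a' j == 0%N]|%:R * sym z a =
    sym z a' * (\sum_i z i ^+ e) - \sum_(j | a' j != 0%N) sym z (b j).
  rewrite sym_power_sum (bigID (fun j => a' j != 0%N)) /= [X in _ = X - _]addrC addrK.
  under [RHS]eq_bigl do rewrite negbK.
  rewrite [RHS](eq_bigr (fun=> sym z a)); last by move=> j /eqP /b0.
  by rewrite sumr_const mulr_natl.
have ne0 : #|[pred j | a' j == 0%N]|%:R != 0 :> R.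
  rewrite pnatr_eq0 -lt0n; apply/card_gt0P; exists i0.
  by rewrite inE /a' eqxx.
apply: (mulfI ne0); rewrite !main IHa' eq_power_sums; last first.
  by rewrite (leq_trans _ lek) // sumaE leq_addr.
by congr (_ - _); apply: eq_bigr => j /IHb.
Qed.

Lemma prod_seq_count (f : I -> R) (l : seq I) :
  \prod_(b <- l) f b = \prod_i f i ^+ count_mem i l.
Proof.
elim: l => [|b l IH]; first by rewrite big_nil big1.
rewrite big_cons IH /=; under [RHS]eq_bigr do rewrite exprD.
rewrite big_split /=; congr (_ * _).
rewrite (bigD1 b) //= eqxx big1 ?mulr1 // => i /negPf nb.
by rewrite [b == i]eq_sym nb.
Qed.

Lemma eq_sum_perm_prod (l : seq I) : (size l <= k)%N ->
  \sum_(s : {perm I}) \prod_(b <- l) x (s b)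
    = \sum_(s : {perm I}) \prod_(b <- l) y (s b).
Proof.
move=> lek; under eq_bigr do rewrite prod_seq_count.
under [RHS]eq_bigr do rewrite prod_seq_count.
apply: eq_symmetrization; rewrite (leq_trans _ lek) //.
elim: l {lek} => [|b l IH] /=; first by rewrite big1.
rewrite big_split /= -add1n leq_add // (bigD1 b) //= eqxx big1 ?addn0 //.
by move=> i /negPf nb; rewrite [b == i]eq_sym nb.
Qed.

End Symmetrization.

Local Open Scope classical_set_scope.
Local Open Scope ring_scope.

(** * Calculus in coordinate space *)

(** Balls with rational centres and radii 1 / (N + 1) form a countable basis. *)
Lemma rV_second_countable (R : realType) n : @second_countable 'rV[R]_n.
Proof.
pose f (q : 'rV[rat]_n * nat) : set 'rV[R]_n :=
  (ball (map_mx ratr q.1 : 'rV[R]_n) q.2.+1%:R^-1)°.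
exists (range f); last split.
- exact: (card_le_trans (card_image_le _ _) (countableP _)).
- by move=> _ [q _ <-]; exact: open_interior.
move=> x V /nbhs_ballP[e /= e0 ballV].
have [N] := @ltr_add_invr R 0 (e / 2) (divr_gt0 e0 (ltr0Sn _ 1)).
rewrite add0r => ltNe.
have r0 : 0 < N.+1%:R^-1 :> R by [].
have [q xq] : exists q : 'rV[rat]_n,
    ball (map_mx ratr q : 'rV[R]_n) (N.+1%:R^-1 / 2) x.
  have q_ i : {q : rat | ratr q \in `]x 0 i - N.+1%:R^-1 / 2,
                                      x 0 i + N.+1%:R^-1 / 2[}.
    apply: cid; have [|q] := @rat_in_itvoo R (x 0 i - N.+1%:R^-1 / 2)
      (x 0 i + N.+1%:R^-1 / 2); last by exists q.
    by move: r0; move: (N.+1%:R^-1) => r r0; lra.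
  exists (\row_i sval (q_ i)); split; first by rewrite divr_gt0.
  move=> i j; rewrite !mxE ord1; case: (q_ j) => q /=.
  rewrite in_itv /= /ball /= => /andP[q1 q2].
  rewrite ltr_norml; move: q1 q2.
  by move: (N.+1%:R^-1) (ratr q) (x 0 j) => r u w *; apply/andP; split; lra.
exists (f (q, N)).
  split; first by exists (q, N).
  apply/nbhs_ballP; exists (N.+1%:R^-1 / 2) => /=; first by rewrite divr_gt0.
  move=> y xy; rewrite [_^-1]splitr; exact: ball_triangle xq xy.
apply: (subset_trans _ ballV) => z /interior_subset /= qz.
rewrite [e]splitr; apply: (@ball_triangle _ _ (map_mx ratr q : 'rV[R]_n)).
  apply/ball_sym; apply: le_ball xq.
  by apply: (le_trans _ (ltW ltNe)); rewrite ler_piMr // ?ltW // invf_lt1 // ltr1n.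
by apply: le_ball qz; exact: ltW.
Qed.

Section Calculus.
Variables (R : realType) (n : nat).
Implicit Types (A : set 'rV[R]_n) (z : 'rV[R]_n).

Lemma continuous_mx (T : topologicalType) p q (f : T -> 'M[R]_(p, q)) :
  (forall i j, continuous (fun s => f s i j)) -> continuous f.
Proof.
move=> cf t U [P ftP PU]; rewrite /nbhs /=.
apply: (@filterS _ _ _ [set s | forall i j, P i j (f s i j)]) => [s|].
  exact: PU.
apply: filter_forall => i; apply: filter_forall => j.
exact: (cf i j t) (ftP i j).
Qed.

(** The coordinates are the entries of the identity map, whose derivative in
    the direction v is v. *)
Lemma is_derive_coord (a : 'I_n) z v :
  is_derive z v (fun y : 'rV[R]_n => y 0 a) (v 0 a).
Proof.
apply: DeriveDef; first exact/diff_derivable/differentiable_coord.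
have /(congr1 (fun M : 'rV[R]_n => M 0 a)) :=
  derive_mx (@derivable_id _ _ z v).
by rewrite mxE derive_id => ->.
Qed.

Lemma is_derive_comp_differentiable (V : normedModType R) (f : V -> R)
    (g : R -> R) x v a b :
  differentiable f x -> is_derive x v f b -> is_derive (f x) 1 g a ->
  is_derive x v (g \o f) (b * a).
Proof.
move=> df [_ Df] [dg Dg].
have dg' : differentiable g (f x) by apply/derivable1_diffP.
have dgf : differentiable (g \o f) x by exact: differentiable_comp.
apply: DeriveDef; first exact: diff_derivable.
rewrite deriveE // diff_comp //=. rewrite -(@deriveE _ _ _ f) // Df.
rewrite -[X in 'd _ _ X]mulr1 -[X in 'd _ _ X]/(b *: (1 : R)) linearZ /=.
by rewrite -deriveE // Dg.
Qed.

Lemma is_derive_exp_coord (c w : R) (a : 'I_n) z v :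
  is_derive z v (fun y : 'rV[R]_n => c * expR (w * y 0 a))
    (c * (w * v 0 a) * expR (w * z 0 a)).
Proof.
rewrite -mulrA.
have dwf : differentiable (fun y : 'rV[R]_n => w *: (y 0 a : R)) z.
  by apply: differentiableZ; exact: differentiable_coord.
have := is_deriveZ c (is_derive_comp_differentiable dwf
  (is_deriveZ w (is_derive_coord a z v)) (is_derive_expR _)).
exact.
Qed.

Lemma is_derive_affine_coord (l c : R) (a : 'I_n) z v :
  is_derive z v (fun y : 'rV[R]_n => l * y 0 a + c) (l * v 0 a).
Proof.
rewrite -[X in is_derive _ _ _ X]addr0.
exact: is_deriveD (is_deriveZ l (is_derive_coord a z v)) (is_derive_cst c z v).
Qed.

Definition diag_affine (l c : 'I_n -> R) z : 'rV[R]_n :=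
  \row_a (l a * z 0 a + c a).

Lemma continuous_diag_affine l c : continuous (diag_affine l c).
Proof.
apply: continuous_mx => i a.
have -> : (fun y => diag_affine l c y i a) =
    (fun y : 'rV[R]_n => l a * y 0 a + c a).
  by apply/funext => y; rewrite mxE.
move=> z; apply: differentiable_continuous.
apply: differentiableD; last exact: differentiable_cst.
exact: (differentiableZ (l a) (differentiable_coord z 0 a)).
Qed.

Lemma is_derive_diag_affine l c z v :
  is_derive z v (diag_affine l c) (\row_a (l a * v 0 a)).
Proof.
have E i (a : 'I_n) : (fun y => diag_affine l c y i a) =
    (fun y : 'rV[R]_n => l a * y 0 a + c a).
  by apply/funext => y; rewrite mxE.
have d : derivable (diag_affine l c) z v.
  by apply/derivable_mxP => i a; rewrite E; case: (is_derive_affine_coord (l a) (c a) a z v).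
apply: DeriveDef => //; rewrite derive_mx //; apply/matrixP => i a.
by rewrite !mxE E; case: (is_derive_affine_coord (l a) (c a) a z v).
Qed.

(** The partial derivatives of these maps are again of the same form, with
    l = 0, whence the induction on the order of differentiability. *)
Lemma smooth_diag_affine A l c : smooth_on A (diag_affine l c).
Proof.
move=> r; elim: r l c => [|r IH] l c; split; try by move=> x _; apply: continuous_diag_affine.
  by [].
move=> i; split=> [x _|]; first by case: (is_derive_diag_affine l c x (delta_mx 0 i)).
have -> : partial i (diag_affine l c) =
  diag_affine (fun=> 0) (fun a => l a * (delta_mx 0 i : 'rV_n) 0 a); last exact: IH.
apply/funext => z; rewrite /partial.
case: (is_derive_diag_affine l c z (delta_mx 0 i)) => _ ->.
by apply/rowP => a; rewrite !mxE mul0r add0r.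
Qed.

Lemma jacobian_diag_affine l c z :
  jacobian (diag_affine l c) z = diag_mx (\row_a l a).
Proof.
have E : diag_affine l c = mulmxr (diag_mx (\row_a l a)) \+ cst (\row_a c a).
  by apply/funext => y; apply/rowP => a; rewrite /= mul_mx_diag !mxE mulrC.
have cm : continuous (mulmxr (diag_mx (\row_a l a)) : 'rV[R]_n -> 'rV[R]_n).
  rewrite (_ : mulmxr _ = diag_affine l (fun=> 0) :> (_ -> _)).
    exact: continuous_diag_affine.
  by apply/funext => y; apply/rowP => a; rewrite /= mul_mx_diag !mxE mulrC addr0.
have df : differentiable (diag_affine l c) z.
  rewrite E; apply: differentiableD; last exact: differentiable_cst.
  exact: linear_differentiable.
apply/row_matrixP => i; rewrite !rowE -deriveEjacobian //.
case: (is_derive_diag_affine l c z (delta_mx 0 i)) => _ ->.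
by apply/rowP => a; rewrite mul_mx_diag !mxE mulrC.
Qed.

Variables (w : 'I_n -> R) (tau : 'I_n -> 'I_n).

Definition exp_diag (c : 'I_n -> R) z : 'M[R]_n :=
  diag_mx (\row_a (c a * expR (w a * z 0 (tau a)))).

Lemma exp_diagE c z a b :
  exp_diag c z a b = c a * (a == b)%:R * expR (w a * z 0 (tau a)).
Proof. by rewrite !mxE; case: eqP => _; rewrite ?mulr1n ?mulr0n; ring. Qed.

Lemma is_derive_exp_diag c z v : is_derive z v (exp_diag c)
  (exp_diag (fun a => c a * (w a * v 0 (tau a))) z).
Proof.
have E a b : (fun y => exp_diag c y a b) =
    (fun y : 'rV[R]_n => c a * (a == b)%:R * expR (w a * y 0 (tau a))).
  by apply/funext => y; rewrite exp_diagE.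
have d : derivable (exp_diag c) z v.
  by apply/derivable_mxP => a b; rewrite E; case: (is_derive_exp_coord (c a * (a == b)%:R) (w a) (tau a) z v).
apply: DeriveDef => //; rewrite derive_mx //; apply/matrixP => a b.
rewrite [LHS]mxE E exp_diagE.
case: (is_derive_exp_coord (c a * (a == b)%:R) (w a) (tau a) z v) => _ ->.
by ring.
Qed.

(** The coefficients c are arbitrary in the definition of [exp_diag] so that
    this family is closed under partial derivatives. *)
Lemma smooth_exp_diag A c : smooth_on A (exp_diag c).
Proof.
have cont c' : continuous (exp_diag c').
  apply: continuous_mx => a b.
  have -> : (fun y => exp_diag c' y a b) =
    (fun y : 'rV[R]_n => c' a * (a == b)%:R * expR (w a * y 0 (tau a))).
    by apply/funext => y; rewrite exp_diagE.
  move=> z; apply: differentiable_continuous.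
  have dwf : differentiable (fun y : 'rV[R]_n => w a *: (y 0 (tau a) : R)) z.
    by apply: differentiableZ; exact: differentiable_coord.
  apply: (@differentiableZ _ _ _ (fun y : 'rV[R]_n => expR (w a * y 0 (tau a)))).
  by apply: (differentiable_comp dwf); apply/derivable1_diffP; exact: derivable_expR.
move=> r; elim: r c => [|r IH] c; split; try by move=> x _; apply: cont.
  by [].
move=> i; split=> [x _|]; first by case: (is_derive_exp_diag c x (delta_mx 0 i)).
have -> : partial i (exp_diag c) =
  exp_diag (fun a => c a * (w a * (delta_mx 0 i : 'rV_n) 0 (tau a))); last exact: IH.
apply/funext => z; rewrite /partial.
by case: (is_derive_exp_diag c z (delta_mx 0 i)) => _ ->.
Qed.

End Calculus.

(** * Products of hyperbolic spaces *)

Section CoordinateSpace.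
Variables (R : realType) (n : nat).

Lemma diag_affine_id : id = diag_affine (fun=> 1) (fun=> 0) :> ('rV[R]_n -> _).
Proof. by apply/funext => z; apply/rowP => a; rewrite mxE mul1r addr0. Qed.

Definition rV_chart : chart R n 'rV[R]_n :=
  @Chart R n 'rV[R]_n setT setT id id openT openT
    (fun _ _ => I) (fun _ _ => I) (fun _ _ => erefl) (fun _ _ => erefl)
    (fun x _ => @cvg_id _ (nbhs x)) (fun x _ => @cvg_id _ (nbhs x)).

Definition rV_manifold : manifold R n.
Proof.
apply: (@Manifold R n 'rV[R]_n (@norm_hausdorff _ _)
  (@rV_second_countable R n) _ [set rV_chart] (fun=> rV_chart)) => //.
- by exists 0.
- move=> _ _ -> ->; rewrite (_ : transition _ _ = id) // diag_affine_id.
  exact: smooth_diag_affine.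
Defined.

End CoordinateSpace.

(** The coordinates are grouped by tau: those with the same image under tau are
    the coordinates of one factor, and this common image is its distinguished
    coordinate t.  With c constant on the group, the factor has the metric
    dt^2 + exp(2 c t) (dx_1^2 + ... + dx_q^2), which is the hyperbolic space of
    dimension q + 1 and curvature - c^2 (a euclidean space if c = 0). *)
Section HyperbolicProduct.
Variables (R : realType) (n : nat) (tau : 'I_n -> 'I_n) (c : 'I_n -> R).
Hypotheses (tauK : forall a, tau (tau a) = tau a)
           (c_tau : forall a, c (tau a) = c a).

(** Vanishing on the distinguished coordinates allows one formula for all the
    metric coefficients. *)
Definition growth (a : 'I_n) : R := c a * (a != tau a)%:R.

Lemma growth_tau a : growth (tau a) = 0.
Proof. by rewrite /growth tauK eqxx mulr0. Qed.

Definition metric_coef a (z : 'rV[R]_n) : R := expR (2 * growth a * z 0 (tau a)).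

Definition hyp_metric : 'rV[R]_n -> 'M[R]_n :=
  exp_diag (fun a => 2 * growth a) tau (fun=> 1).

Lemma hyp_metricE z a b : hyp_metric z a b = (a == b)%:R * metric_coef a z.
Proof. by rewrite /hyp_metric exp_diagE mul1r. Qed.

Lemma metric_coef_gt0 a z : 0 < metric_coef a z. Proof. exact: expR_gt0. Qed.

Lemma metric_coef_tau a z : metric_coef (tau a) z = 1.
Proof. by rewrite /metric_coef growth_tau mulr0 mul0r expR0. Qed.

Lemma hyp_metric_diag z : hyp_metric z = diag_mx (\row_a metric_coef a z).
Proof. by apply/matrixP => a b; rewrite hyp_metricE !mxE mulr_natl. Qed.

Lemma hyp_formE z (u v : 'rV[R]_n) :
  (u *m hyp_metric z *m v^T) 0 0 = \sum_a u 0 a * v 0 a * metric_coef a z.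
Proof.
rewrite hyp_metric_diag mul_mx_diag mxE; apply: eq_bigr => a _.
by rewrite !mxE; ring.
Qed.

Lemma hyp_metric_sym z : (hyp_metric z)^T = hyp_metric z.
Proof. by rewrite hyp_metric_diag tr_diag_mx. Qed.

Lemma hyp_metric_pos z (v : 'rV[R]_n) : v != 0 ->
  0 < (v *m hyp_metric z *m v^T) 0 0.
Proof.
move=> v0; rewrite hyp_formE.
have pos a : 0 <= v 0 a * v 0 a * metric_coef a z.
  by rewrite mulr_ge0 ?(ltW (metric_coef_gt0 _ _)) // -expr2 sqr_ge0.
rewrite lt_def sumr_ge0 ?andbT //; apply: contraNN v0.
rewrite psumr_eq0 // => /allP v0; apply/eqP/rowP => a; rewrite mxE.
have := v0 a (mem_index_enum _); rewrite !mulf_eq0 orbb (gt_eqF (metric_coef_gt0 _ _)) orbF.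
by move/eqP.
Qed.

Definition hyp_product : riemannian R n.
Proof.
apply: (@Riemannian R n (rV_manifold R n) (fun=> hyp_metric)).
- by move=> d _; exact: smooth_exp_diag.
- by move=> *; exact: hyp_metric_sym.
- by move=> *; exact: hyp_metric_pos.
- move=> _ _ x -> -> _; rewrite (_ : transition _ _ = id) //.
  rewrite diag_affine_id jacobian_diag_affine.
  have -> : diag_mx (\row_a 1) = 1%:M :> 'M[R]_n.
    by apply/matrixP => i j; rewrite !mxE.
  by rewrite trmx1 mulmx1 mul1mx.
Defined.

(** In the factor with coordinates (t, x) this is the isometry
    (t, x) |-> (t + s, exp(- c s) x + const), where s is the difference of the
    t-coordinates of q and p. *)
Definition hyp_shift (p q : 'rV[R]_n) : 'rV[R]_n -> 'rV[R]_n :=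
  let l a := expR (- (growth a * (q 0 (tau a) - p 0 (tau a)))) in
  diag_affine l (fun a => q 0 a - l a * p 0 a).

Lemma hyp_shift_base p q : hyp_shift p q p = q.
Proof. by apply/rowP => a; rewrite mxE addrC subrK. Qed.

Lemma hyp_shiftK p q : cancel (hyp_shift p q) (hyp_shift q p).
Proof.
move=> z; apply/rowP => a; rewrite !mxE.
set e := expR (- (_ * (q _ _ - _))); set e' := expR _.
have ee' : e' * e = 1.
  by rewrite -expRD -opprD -mulrDr addrA subrK subrr mulr0 oppr0 expR0.
by ring: ee'.
Qed.

Lemma hyp_shift_isometry p q z :
  hyp_metric z = jacobian (hyp_shift p q) z *m hyp_metric (hyp_shift p q z) *m
                   (jacobian (hyp_shift p q) z)^T.
Proof.
rewrite jacobian_diag_affine tr_diag_mx !hyp_metric_diag !mulmx_diag.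
apply/matrixP => a b; rewrite !mxE; congr (_ *+ _).
rewrite /metric_coef !mxE growth_tau mul0r oppr0 expR0 !mul1r.
by rewrite -!expRD; congr expR; ring.
Qed.

Lemma hyp_product_homogeneous : locally_homogeneous hyp_product.
Proof.
have smooth p q : smooth_map_on (M := hyp_product) (N := hyp_product)
    setT (hyp_shift p q).
  split=> [x _|]; first exact: continuous_diag_affine.
  move=> _ _ -> ->; exact: smooth_diag_affine.
move=> p q; exists setT, setT, (hyp_shift p q), (hyp_shift q p).
split=> //; first exact: hyp_shift_base.
split; first by split; exact: openT.
- by split=> x _; split=> //; exact: hyp_shiftK.
- by split; exact: smooth.
- by move=> _ _ x -> -> _; exact: hyp_shift_isometry.
Qed.

End HyperbolicProduct.

(** * Curvature of products of hyperbolic spaces *)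

Section HyperbolicCurvature.
Variables (R : realType) (n : nat) (tau : 'I_n -> 'I_n) (c : 'I_n -> R).
Hypotheses (tauK : forall a, tau (tau a) = tau a)
           (c_tau : forall a, c (tau a) = c a).
Notation w := (growth tau c).
Notation h := (metric_coef tau c).
Notation G := (hyp_metric tau c).

Lemma hyp_invmx z a b : invmx (G z) a b = (a == b)%:R / h a z.
Proof.
have GV : G z *m diag_mx (\row_a (h a z)^-1) = 1%:M.
  rewrite hyp_metric_diag mulmx_diag; apply/matrixP => i j; rewrite !mxE.
  by rewrite mulfV // gt_eqF // metric_coef_gt0.
have [Gu _] := mulmx1_unit GV.
have -> : invmx (G z) = diag_mx (\row_a (h a z)^-1).
  by rewrite -[LHS]mulmx1 -GV mulKmx.
by rewrite !mxE mulr_natl.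
Qed.

Lemma is_derive_hyp_metric (e a b : 'I_n) z :
  is_derive z (delta_mx 0 e) (fun y => G y a b)
    ((a == b)%:R * (2 * w a * (e == tau a)%:R * h a z)).
Proof.
have -> : (fun y => G y a b) = (fun y : 'rV[R]_n =>
    (a == b)%:R * expR (2 * w a * y 0 (tau a))).
  by apply/funext => y; rewrite hyp_metricE.
have := is_derive_exp_coord (a == b)%:R (2 * w a) (tau a) z (delta_mx 0 e).
rewrite mxE eqxx /= [tau a == e]eq_sym => D.
by apply: (is_derive_eq D); rewrite -mulrA.
Qed.

Lemma partial_hyp_metric (e a b : 'I_n) z :
  partial e (fun y => G y a b) z
    = (a == b)%:R * (2 * w a * (e == tau a)%:R * h a z).
Proof. by have [_ D] := is_derive_hyp_metric e a b z; exact: D. Qed.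

(** Since the metric coefficient of a depends on the coordinate tau a only, a
    nonzero symbol has the indices tau a, a, a in some order.  The last term
    lacks the factor 1 / metric_coef d, which is 1 for d = tau a. *)
Lemma hyp_christoffel (d a b : 'I_n) z : christoffel G d a b z =
  w d * (b == d)%:R * (a == tau d)%:R + w d * (a == d)%:R * (b == tau d)%:R
  - w a * (a == b)%:R * (d == tau a)%:R * h a z.
Proof.
rewrite /christoffel (bigD1 d) //= big1 ?addr0; last first.
  by move=> i /negPf id; rewrite hyp_invmx eq_sym id !mul0r.
rewrite hyp_invmx eqxx !partial_hyp_metric.
have hd0 : h d z != 0 by rewrite gt_eqF // metric_coef_gt0.
have E1 : (b == d)%:R * (2 * w b * (a == tau b)%:R * h b z) =
    2 * (w d * (b == d)%:R * (a == tau d)%:R) * h d z.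
  by case: (b =P d) => [->|_] /=; ring.
have E2 : (a == d)%:R * (2 * w a * (b == tau a)%:R * h a z) =
    2 * (w d * (a == d)%:R * (b == tau d)%:R) * h d z.
  by case: (a =P d) => [->|_] /=; ring.
have E3 : (d == tau a)%:R = (d == tau a)%:R * h d z.
  by case: (d =P tau a) => [->|_]; rewrite ?metric_coef_tau // /=; ring.
by rewrite E1 E2 {1}E3 /=; field.
Qed.

Lemma is_derive_metric_coef (e a : 'I_n) z :
  is_derive z (delta_mx 0 e) (h a) (2 * w a * (e == tau a)%:R * h a z).
Proof.
have E : (fun y => G y a a) = h a.
  by apply/funext => y; rewrite hyp_metricE eqxx mul1r.
by have := is_derive_hyp_metric e a a z; rewrite E eqxx mul1r.
Qed.

Lemma partial_christoffel (e d a b : 'I_n) z :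
  partial e (christoffel G d a b) z =
  - (2 * w a ^+ 2 * (a == b)%:R * (d == tau a)%:R * (e == tau a)%:R * h a z).
Proof.
pose k1 := w d * (b == d)%:R * (a == tau d)%:R + w d * (a == d)%:R * (b == tau d)%:R.
pose k2 := - (w a * (a == b)%:R * (d == tau a)%:R).
have -> : christoffel G d a b = cst k1 + k2 *: h a.
  by apply/funext => y; rewrite hyp_christoffel /k1 /k2 -mulNr.
have [_] := is_deriveD (is_derive_cst k1 z (delta_mx 0 e))
              (is_deriveZ k2 (is_derive_metric_coef e a z)).
by rewrite /partial => ->; rewrite add0r /k2 /GRing.scale /=; ring.
Qed.

(** The Levi-Civita connection of a product preserves the factors. *)
Lemma christoffel_block (d a b : 'I_n) z :
  christoffel G d a b z != 0 -> tau a = tau b /\ tau d = tau b.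
Proof.
rewrite hyp_christoffel.
case: (b =P d) => [->|_].
  case: (a =P tau d) => [->|_]; first by rewrite tauK.
  case: (a =P d) => [->|_]; first by [].
  by rewrite !(mulr0, mul0r) addr0 subrr eqxx.
rewrite mulr0 mul0r add0r.
case: (a =P d) => [->|_].
  case: (b =P tau d) => [->|_]; first by rewrite tauK.
  case: (d =P b) => [->|_]; first by [].
  by rewrite !(mulr0, mul0r) subrr eqxx.
rewrite mulr0 mul0r add0r.
case: (a =P b) => [->|_]; last by rewrite !(mulr0, mul0r) oppr0 eqxx.
case: (d =P tau b) => [->|_]; first by rewrite tauK.
by rewrite !(mulr0, mul0r) oppr0 eqxx.
Qed.

Lemma sum_delta (F : 'I_n -> R) (b : 'I_n) : \sum_e F e * (e == b)%:R = F b.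
Proof.
rewrite (bigD1 b) //= eqxx mulr1 big1 ?addr0 // => e /negPf->.
by rewrite mulr0.
Qed.

(** The factor through a has constant curvature - c a ^ 2, and the factors do
    not interact.  If a, b, d, e are not all coordinates of the same factor,
    every term vanishes, because Christoffel symbols stay within a factor.
    Otherwise the only index that matters besides them is the distinguished
    coordinate t of that factor, and the identity is checked for each of the
    possible coincidences between a, b, d, e and t. *)
Lemma hyp_riem (a b d e : 'I_n) z : riem G a b d e z =
  - c a ^+ 2 * (tau a == tau b)%:R *
  ((b == d)%:R * (a == e)%:R * h b z - (a == d)%:R * (b == e)%:R * h a z).
Proof.
have sumE p q : \sum_i christoffel G e p i z * christoffel G i q d z =
    w d * (q == tau d)%:R * christoffel G e p d z
    + w q * (d == tau q)%:R * christoffel G e p q z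
    - w q * (q == d)%:R * h q z * christoffel G e p (tau q) z.
  pose F i := christoffel G e p i z.
  have X k x : x * F k = \sum_i x * F i * (i == k)%:R.
    by rewrite (sum_delta (fun i => x * F i)).
  rewrite -[christoffel G e p d z]/(F d) -[christoffel G e p q z]/(F q).
  rewrite -[christoffel G e p (tau q) z]/(F (tau q)) !X -big_split -sumrB /=.
  apply: eq_bigr => i _; rewrite -/(F i).
  rewrite [christoffel G i q d z]hyp_christoffel [d == i]eq_sym [q == i]eq_sym.
  (* The terms of christoffel i q d are supported on i = d, i = q, i = tau q. *)
  have E k l : w i * (i == k)%:R * (l == tau i)%:R =
      w k * (l == tau k)%:R * (i == k)%:R.
    by case: (i =P k) => [->|_] /=; ring.
  by rewrite !E; ring.
have [/and3P[/eqP tab /eqP tbd /eqP ted]|nsame] :=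
  boolP [&& tau a == tau b, tau b == tau d & tau e == tau d]; last first.
  have z1 : (b == d)%:R * (e == tau b)%:R * (a == tau b)%:R = 0 :> R.
    move: nsame; case: (b =P d) => [<-|_]; last by rewrite !mul0r.
    case: (e =P tau b) => [->|_]; last by rewrite mulr0 mul0r.
    case: (a =P tau b) => [->|_]; last by rewrite mulr0.
    by rewrite !tauK !eqxx.
  have z2 : (a == d)%:R * (e == tau a)%:R * (b == tau a)%:R = 0 :> R.
    move: nsame; case: (a =P d) => [<-|_]; last by rewrite !mul0r.
    case: (e =P tau a) => [->|_]; last by rewrite mulr0 mul0r.
    case: (b =P tau a) => [->|_]; last by rewrite mulr0.
    by rewrite !tauK !eqxx.
  have z3 : (tau a == tau b)%:R * (b == d)%:R * (a == e)%:R = 0 :> R.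
    move: nsame; case: (b =P d) => [<-|_]; last by rewrite mulr0 mul0r.
    case: (a =P e) => [<-|_]; last by rewrite mulr0.
    by rewrite eqxx /= andbb => /negPf->; rewrite !mul0r.
  have z4 : (tau a == tau b)%:R * (a == d)%:R * (b == e)%:R = 0 :> R.
    move: nsame; case: (a =P d) => [<-|_]; last by rewrite mulr0 mul0r.
    case: (b =P e) => [<-|_]; last by rewrite mulr0.
    by rewrite [tau b == _]eq_sym !andbb => /negPf->; rewrite !mul0r.
  rewrite /riem !partial_christoffel big1 => [|i _].
    apply/eqP; rewrite -subr_eq0; apply/eqP.
    transitivity (
      2 * w a ^+ 2 * h a z * ((a == d)%:R * (e == tau a)%:R * (b == tau a)%:R)
      - 2 * w b ^+ 2 * h b z * ((b == d)%:R * (e == tau b)%:R * (a == tau b)%:R)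
      + c a ^+ 2 * h b z * ((tau a == tau b)%:R * (b == d)%:R * (a == e)%:R)
      - c a ^+ 2 * h a z * ((tau a == tau b)%:R * (a == d)%:R * (b == e)%:R)).
      by ring.
    by rewrite z1 z2 z3 z4; ring.
  have prod0 p q : ~~ [&& tau p == tau d, tau q == tau d & tau e == tau d] ->
      christoffel G e p i z * christoffel G i q d z = 0.
    have [->|/christoffel_block[-> ->]] := eqVneq (christoffel G e p i z) 0.
      by rewrite mul0r.
    have [->|/christoffel_block[-> ->]] := eqVneq (christoffel G i q d z) 0.
      by rewrite mulr0.
    by rewrite eqxx.
  by rewrite !prod0 ?subrr //; apply: contra nsame => /and3P[/eqP-> /eqP-> ->];
     rewrite eqxx.
pose t := tau d; pose k := c t.
have wE x : tau x = t -> w x = k * (x != t)%:R.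
  by move=> tx; rewrite /growth tx /k -c_tau tx.
have ht : h t z = 1 by rewrite /t metric_coef_tau.
rewrite /riem !partial_christoffel sumrB !sumE !hyp_christoffel.
have ta := etrans tab tbd.
rewrite tab tbd ted -/t eqxx -[c a]c_tau ta -/t -/k ?growth_tau.
rewrite (wE a ta) (wE b tbd) (wE d erefl) (wE e ted).
clear sumE wE tab tbd ted ta; clearbody k; clearbody t.
repeat match goal with |- context [?x == ?y] =>
  case: (eqVneq x y) => [?|?]; [subst|]; rewrite ?eqxx;
  try match goal with N : is_true (?x != ?x) |- _ => by rewrite eqxx in N end
  end; rewrite ?ht /=; ring.
Qed.

(** The curvature tensor written with metric coefficients, which are parallel,
    instead of Kronecker symbols. *)
Definition hyp_curv (p q r s : 'I_n) z : R :=
  - c p ^+ 2 * (tau p == tau q)%:R * (G z q r * G z p s - G z p r * G z q s).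

Lemma hyp_riem_tensor (t : 4.-tuple 'I_n) z : riem_tensor G t z =
  hyp_curv (tnth t (inord 0)) (tnth t (inord 1))
           (tnth t (inord 2)) (tnth t (inord 3)) z.
Proof.
rewrite /riem_tensor; move: (tnth t _) (tnth t _) (tnth t _) (tnth t _) => s r q p.
under eq_bigr do rewrite hyp_metricE mulrCA mulrC.
rewrite sum_delta hyp_riem // /hyp_curv !hyp_metricE.
have E i : (i == s)%:R * h i z = (i == s)%:R * h s z.
  by case: (i =P s) => [->|_] //; rewrite !mul0r.
by rewrite !E; ring.
Qed.

Lemma hyp_metricC z a b : G z a b = G z b a.
Proof.
by rewrite !hyp_metricE; case: eqVneq => [->|_] //; rewrite !mul0r.
Qed.

Definition lowered_christoffel (e p q : 'I_n) z : R :=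
  christoffel G q e p z * h q z.

Lemma sum_christoffel_metric e p q z :
  \sum_i christoffel G i e p z * G z i q = lowered_christoffel e p q z.
Proof.
under eq_bigr do rewrite hyp_metricE mulrCA mulrC.
by rewrite sum_delta.
Qed.

Lemma metric_compatible (e p q : 'I_n) z :
  is_derive z (delta_mx 0 e) (fun y => G y p q)
    (lowered_christoffel e p q z + lowered_christoffel e q p z).
Proof.
apply: (is_derive_eq (is_derive_hyp_metric e p q z)).
rewrite /lowered_christoffel !hyp_christoffel //.
have E1 : w q * (p == q)%:R * (e == tau q)%:R * h q z =
    w p * (p == q)%:R * (e == tau p)%:R * h p z.
  by case: (p =P q) => [->|_] //=; ring.
have E2 i j : w i * (e == i)%:R * (j == tau i)%:R * h i z =
    w e * (e == i)%:R * (j == tau e)%:R * h e z * h j z.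
  case: (e =P i) => [->|_] /=; last by ring.
  by case: (j =P tau i) => [->|_] /=; rewrite ?metric_coef_tau //; ring.
rewrite !(mulrBl, mulrDl) !E2 E1 [q == p]eq_sym.
by ring.
Qed.

(** Contracting an index with a Christoffel symbol does not leave the factor of
    that index, so that the scalar prefactor of [hyp_curv] is not affected. *)
Lemma sum_hyp_curv e p q r s z :
  [/\ \sum_i christoffel G i e p z * hyp_curv i q r s z =
      - c p ^+ 2 * (tau p == tau q)%:R *
       (G z q r * lowered_christoffel e p s z - lowered_christoffel e p r z * G z q s),
     \sum_i christoffel G i e q z * hyp_curv p i r s z =
      - c p ^+ 2 * (tau p == tau q)%:R *
       (lowered_christoffel e q r z * G z p s - G z p r * lowered_christoffel e q s z),
     \sum_i christoffel G i e r z * hyp_curv p q i s z =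
      - c p ^+ 2 * (tau p == tau q)%:R *
       (lowered_christoffel e r q z * G z p s - lowered_christoffel e r p z * G z q s) &
     \sum_i christoffel G i e s z * hyp_curv p q r i z =
      - c p ^+ 2 * (tau p == tau q)%:R *
       (G z q r * lowered_christoffel e s p z - G z p r * lowered_christoffel e s q z)].
Proof.
have block F K i k : (tau i = tau k -> F = K) ->
    christoffel G i e k z * F = christoffel G i e k z * K :> R.
  have [->|/christoffel_block[_ tik FK]] := eqVneq (christoffel G i e k z) 0.
    by rewrite !mul0r.
  by rewrite FK.
rewrite -!sum_christoffel_metric !mulr_sumr !mulr_suml -!sumrB !mulr_sumr.
split; apply: eq_bigr => i _.
- rewrite (block _ (- c p ^+ 2 * (tau p == tau q)%:R *
      (G z q r * G z i s - G z i r * G z q s))); first by ring.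
  by move=> tip; rewrite /hyp_curv -c_tau tip c_tau.
- rewrite (block _ (- c p ^+ 2 * (tau p == tau q)%:R *
      (G z i r * G z p s - G z p r * G z i s))); first by ring.
  by move=> tiq; rewrite /hyp_curv tiq.
- rewrite /hyp_curv ![G z _ i]hyp_metricC; ring.
- rewrite /hyp_curv ![G z _ i]hyp_metricC; ring.
Qed.

Lemma inord4 : [/\ inord 0 = ord0 :> 'I_4, inord 1 = lift ord0 ord0 :> 'I_4,
  inord 2 = lift ord0 (lift ord0 ord0) :> 'I_4 &
  inord 3 = lift ord0 (lift ord0 (lift ord0 ord0)) :> 'I_4].
Proof. by split; apply: val_inj; rewrite /= inordK. Qed.

(** Products of hyperbolic spaces are locally symmetric: the curvature tensor is
    a sum of products of parallel tensors, with locally constant weights on the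
    factors.  In coordinates, the four correction terms given by [sum_hyp_curv]
    match the Leibniz rule and the compatibility of the metric. *)
Lemma cov_deriv_hyp t z : cov_deriv G (riem_tensor G) t z = 0.
Proof.
rewrite /cov_deriv; move: (thead t) (behead_tuple t) => e b /=.
have -> : riem_tensor G b = hyp_curv (tnth b (inord 0)) (tnth b (inord 1))
           (tnth b (inord 2)) (tnth b (inord 3)).
  by apply/funext => y; rewrite hyp_riem_tensor.
under eq_bigr do under eq_bigr do rewrite hyp_riem_tensor !tnth_mktuple.
have [-> -> -> ->] := inord4.
rewrite !big_ord_recl big_ord0 addr0 /=.
rewrite /bump /=.
move: (tnth b _) (tnth b _) (tnth b _) (tnth b _) => s r q p.
have [-> -> -> ->] := sum_hyp_curv e p q r s z.
have D : is_derive z (delta_mx 0 e) (hyp_curv p q r s)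
    (- c p ^+ 2 * (tau p == tau q)%:R *
      ((lowered_christoffel e q r z + lowered_christoffel e r q z) * G z p s
       + G z q r * (lowered_christoffel e p s z + lowered_christoffel e s p z)
       - ((lowered_christoffel e p r z + lowered_christoffel e r p z) * G z q s
       + G z p r * (lowered_christoffel e q s z + lowered_christoffel e s q z)))).
  have -> : hyp_curv p q r s = (- c p ^+ 2 * (tau p == tau q)%:R) *:
      ((fun y => G y q r) * (fun y => G y p s)
       - (fun y => G y p r) * (fun y => G y q s)) by [].
  have D := is_deriveZ (- c p ^+ 2 * (tau p == tau q)%:R)
    (is_deriveB (is_deriveM (metric_compatible e q r z) (metric_compatible e p s z))
                (is_deriveM (metric_compatible e p r z) (metric_compatible e q s z))).
  by apply: (is_derive_eq D); rewrite /GRing.scale /=; ring.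
case: D => _ D; rewrite [partial _ _ _]D; ring.
Qed.

Lemma iter_cov_deriv_hyp m t z : iter_cov_deriv_riem G m.+1 t z = 0.
Proof.
elim: m t z => [|m IH] t z; first exact: cov_deriv_hyp.
rewrite /= -/(iter_cov_deriv_riem G m.+1) /cov_deriv.
rewrite (_ : iter_cov_deriv_riem G m.+1 _ = cst 0); last first.
  by apply/funext => y; exact: IH.
rewrite /partial derive_cst big1 ?subr0 // => i _.
by rewrite big1 // => j _; rewrite IH mulr0.
Qed.

(** The normalized coordinate frame, reordered by s. *)
Definition hyp_frame (s : 'I_n -> 'I_n) (p : 'rV[R]_n) : 'M[R]_n :=
  \matrix_(i, j) ((j == s i)%:R * expR (- (w j * p 0 (tau j)))).

Lemma expR_metric_coef (p : 'rV[R]_n) j :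
  expR (- (w j * p 0 (tau j))) ^+ 2 * h j p = 1.
Proof.
by rewrite /metric_coef expr2 -!expRD -[RHS]expR0; congr expR; ring.
Qed.

Lemma hyp_frame_orthonormal (s : 'I_n -> 'I_n) (p : hyp_product tau c) :
  injective s -> orthonormal p (hyp_frame s p).
Proof.
move=> inj_s i j; rewrite /inner /= hyp_formE.
have E a : row i (hyp_frame s p) 0 a * row j (hyp_frame s p) 0 a * h a p =
    (a == s j)%:R * (a == s i)%:R.
  rewrite !mxE -[RHS]mulr1 -(expR_metric_coef p a); ring.
under eq_bigr do rewrite E.
by rewrite sum_delta (inj_eq inj_s).
Qed.

Lemma sum_tuple_delta k (a : 'I_k -> 'I_n) (v : 'I_n -> R)
    (F : k.-tuple 'I_n -> R) :
  \sum_(q : k.-tuple 'I_n)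
      (\prod_(u < k) ((tnth q u == a u)%:R * v (tnth q u))) * F q
    = (\prod_(u < k) v (a u)) * F [tuple a u | u < k].
Proof.
rewrite (bigD1 [tuple a u | u < k]) //= [X in _ + X]big1 ?addr0 => [|q nq].
  congr (_ * _); apply: eq_bigr => u _.
  by rewrite tnth_mktuple eqxx mul1r.
have [u nu] : exists u, tnth q u != a u.
  apply/existsP; apply: contraNT nq; rewrite negb_exists => /forallP eq_qa.
  apply/eqP/eq_from_tnth => u; rewrite tnth_mktuple.
  by apply/eqP; rewrite -[_ == _]negbK eq_qa.
by rewrite (bigD1 u) //= (negPf nu) !mul0r.
Qed.

Definition curv_coef (t : 4.-tuple 'I_n) : R :=
  let p := tnth t ord0 in let q := tnth t (inord 1) in
  let r := tnth t (inord 2) in let s := tnth t (inord 3) in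
  - c p ^+ 2 * (tau p == tau q)%:R *
  ((q == r)%:R * (p == s)%:R - (p == r)%:R * (q == s)%:R).

(** Each index occurs twice in a nonzero coefficient, so the normalizing factors
    of the frame cancel the metric coefficients. *)
Lemma frame_coef0 (s : 'I_n -> 'I_n) (p : hyp_product tau c) (t : 4.-tuple 'I_n) :
  frame_coef p (hyp_frame s p) (m := 0) t = curv_coef [tuple s (tnth t u) | u < 4].
Proof.
rewrite /frame_coef /=.
under eq_bigr do under eq_bigr do rewrite mxE.
rewrite (@sum_tuple_delta 4 (fun u => s (tnth t u))
  (fun j => expR (- (w j * p 0 (tau j))))).
rewrite hyp_riem_tensor /hyp_curv /curv_coef.
have [-> -> -> ->] := inord4.
rewrite !tnth_mktuple !big_ord_recl big_ord0 mulr1 !hyp_metricE.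
rewrite /bump /=.
move: (s _) (s _) (s _) (s _) => d3 d2 d1 d0.
pose u j := expR (- (w j * p 0 (tau j))).
have E i j k l : (i == j)%:R * (k == l)%:R * (u i * u j * u k * u l)
    * (h i p * h k p) = (i == j)%:R * (k == l)%:R.
  case: (i =P j) => [<-|_]; last by rewrite !mul0r.
  case: (k =P l) => [<-|_]; last by rewrite mulr0 !mul0r.
  transitivity ((u i ^+ 2 * h i p) * (u k ^+ 2 * h k p)); first by rewrite /=; ring.
  by rewrite !expR_metric_coef mulr1.
rewrite -(E d1 d2 d0 d3) -(E d0 d2 d1 d3) -/(u d0) -/(u d1) -/(u d2) -/(u d3).
by ring.
Qed.

Lemma frame_coefS (s : 'I_n -> 'I_n) (p : hyp_product tau c) m t :
  frame_coef p (hyp_frame s p) (m := m.+1) t = 0.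
Proof. by rewrite /frame_coef big1 // => q _; rewrite iter_cov_deriv_hyp mulr0. Qed.

End HyperbolicCurvature.

(** * Sectional curvatures as an obstruction to curvature equivalence *)

(** At the origin all metric coefficients are 1, so that the coordinate frame is
    orthonormal there. *)
Section SectionalCurvature.
Variables (R : realType) (n : nat) (tau : 'I_n -> 'I_n) (c : 'I_n -> R).
Hypotheses (tauK : forall a, tau (tau a) = tau a)
           (c_tau : forall a, c (tau a) = c a).
Let M := hyp_product tau c.

Lemma metric_coef_0 a : metric_coef tau c a 0 = 1.
Proof. by rewrite /metric_coef mxE mulr0 expR0. Qed.

Lemma inner0 (u v : 'rV[R]_n) : inner (0 : M) u v = \sum_a u 0 a * v 0 a.
Proof.
by rewrite /inner /= hyp_formE; apply: eq_bigr => a _; rewrite metric_coef_0 mulr1.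
Qed.

Definition same_factor a b : R := (tau a == tau b)%:R.

Lemma sectional_form (X Y : 'rV[R]_n) :
  inner (0 : M) (curvature_op (0 : M) X Y Y) X =
  - \sum_a \sum_b c a ^+ 2 * same_factor a b *
     ((X 0 a * Y 0 b) ^+ 2 - X 0 a * Y 0 b * (X 0 b * Y 0 a)).
Proof.
rewrite inner0.
have E d : curvature_op (0 : M) X Y Y 0 d = \sum_a \sum_b
    (- c a ^+ 2 * same_factor a b * X 0 a * Y 0 b * Y 0 b * (d == a)%:R
     + c a ^+ 2 * same_factor a b * X 0 a * Y 0 b * Y 0 a * (d == b)%:R).
  rewrite mxE; apply: eq_bigr => a _; apply: eq_bigr => b _.
  rewrite -(sum_delta (fun e => - c a ^+ 2 * same_factor a b * X 0 a * Y 0 b * Y 0 e * (d == a)%:R)).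
  rewrite -(sum_delta (fun e => c a ^+ 2 * same_factor a b * X 0 a * Y 0 b * Y 0 e * (d == b)%:R) a).
  rewrite -big_split; apply: eq_bigr => e _ /=.
  rewrite hyp_riem // !metric_coef_0 [b == e]eq_sym [a == e]eq_sym.
  by rewrite [a == d]eq_sym [b == d]eq_sym /same_factor; ring.
under eq_bigr do rewrite E mulr_suml.
rewrite exchange_big -sumrN; apply: eq_bigr => a _ /=.
under eq_bigr do rewrite mulr_suml.
rewrite exchange_big -sumrN; apply: eq_bigr => b _ /=.
rewrite (eq_bigr (fun d => (- c a ^+ 2 * same_factor a b * X 0 a * Y 0 b * Y 0 b * X 0 d) * (d == a)%:R
     + (c a ^+ 2 * same_factor a b * X 0 a * Y 0 b * Y 0 a * X 0 d) * (d == b)%:R)); last first.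
  by move=> d _; ring.
rewrite big_split /= (sum_delta (fun d => - c a ^+ 2 * same_factor a b * X 0 a * Y 0 b * Y 0 b * X 0 d)).
rewrite (sum_delta (fun d => c a ^+ 2 * same_factor a b * X 0 a * Y 0 b * Y 0 a * X 0 d)).
by ring.
Qed.

(** The form is a combination, with coefficients between 0 and K which are
    symmetric in a and b, of the terms f a b.  Symmetrizing in a and b turns
    these into squares, so that each coefficient may be replaced by K; the sum of
    all f a b is |X|^2 |Y|^2 - <X, Y>^2. *)
Lemma sectional_form_bound (K : R) (X Y : 'rV[R]_n) :
  0 <= K -> (forall a, c a ^+ 2 <= K) ->
  - inner (0 : M) (curvature_op (0 : M) X Y Y) X
    <= K * (inner (0 : M) X X * inner (0 : M) Y Y).
Proof.
move=> K0 leK; rewrite sectional_form opprK.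
pose f a b : R := (X 0 a * Y 0 b) ^+ 2 - X 0 a * Y 0 b * (X 0 b * Y 0 a).
have fE a b : f a b + f b a = (X 0 a * Y 0 b - X 0 b * Y 0 a) ^+ 2.
  by rewrite /f; ring.
have symm (g : 'I_n -> 'I_n -> R) : (forall a b, g a b = g b a) ->
    2 * (\sum_a \sum_b g a b * f a b) = \sum_a \sum_b g a b * (f a b + f b a).
  move=> gC; rewrite mulr_natl mulr2n {2}exchange_big -big_split /=.
  apply: eq_bigr => a _; rewrite -big_split; apply: eq_bigr => b _ /=.
  by rewrite (gC b a); ring.
have sfC a b : c a ^+ 2 * same_factor a b = c b ^+ 2 * same_factor b a.
  rewrite /same_factor [tau b == _]eq_sym; case: eqP => [ab|]; rewrite ?mulr0 //.
  by rewrite -(c_tau a) ab c_tau.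
rewrite -(ler_pM2l (ltr0Sn R 1)) symm //.
apply: (@le_trans _ _ (K * \sum_a \sum_b 1 * (f a b + f b a))).
  rewrite mulr_sumr; apply: ler_sum => a _; rewrite mulr_sumr.
  apply: ler_sum => b _; rewrite mul1r fE ler_wpM2r ?sqr_ge0 //.
  by rewrite /same_factor; case: eqP => _; rewrite ?mulr1 ?mulr0.
rewrite -symm // mulrCA ler_pM2l // ler_wpM2l // !inner0.
have -> : \sum_a \sum_b 1 * f a b = (\sum_a X 0 a * X 0 a) * (\sum_b Y 0 b * Y 0 b)
    - (\sum_a X 0 a * Y 0 a) ^+ 2.
  rewrite expr2 !mulr_suml -sumrB; apply: eq_bigr => a _.
  by rewrite !mulr_sumr -sumrB; apply: eq_bigr => b _; rewrite /f; ring.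
by rewrite gerBl sqr_ge0.
Qed.

Lemma inner_delta0 a : inner (0 : M) (delta_mx 0 a) (delta_mx 0 a) = 1.
Proof.
rewrite inner0; under eq_bigr do rewrite mxE eqxx /=.
by rewrite sum_delta eqxx.
Qed.

Lemma sectional_form_delta a b : a != b ->
  - inner (0 : M) (curvature_op (0 : M) (delta_mx 0 a) (delta_mx 0 b)
                     (delta_mx 0 b)) (delta_mx 0 a)
    = c a ^+ 2 * same_factor a b.
Proof.
move=> /negPf nab; rewrite sectional_form opprK.
transitivity (\sum_i (\sum_j c i ^+ 2 * same_factor i j * (j == b)%:R) * (i == a)%:R).
  apply: eq_bigr => i _; rewrite mulr_suml; apply: eq_bigr => j _.
  rewrite !mxE !eqxx /=; have [->|_] := eqVneq i a; rewrite ?nab.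
    by case: (j == b) => /=; ring.
  by rewrite /=; ring.
rewrite (sum_delta (fun i => \sum_j c i ^+ 2 * same_factor i j * (j == b)%:R)).
by rewrite (sum_delta (fun j => c a ^+ 2 * same_factor a j)).
Qed.

End SectionalCurvature.

(** * Products of surfaces and their curvature invariants *)

(** The i-th factor has lshift m i as distinguished coordinate t and rshift m i
    as coordinate x. *)
Section TwoDimensionalFactors.
Variables (R : realType) (m : nat).

Definition factor (a : 'I_(m + m)) : 'I_m :=
  match fintype.split a with inl i => i | inr i => i end.

Lemma factorl i : factor (lshift m i) = i.
Proof. by rewrite /factor (unsplitK (inl i)). Qed.
Lemma factorr i : factor (rshift m i) = i.
Proof. by rewrite /factor (unsplitK (inr i)). Qed.

Definition axis (a : 'I_(m + m)) : 'I_(m + m) := lshift m (factor a).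

Lemma axisK a : axis (axis a) = axis a.
Proof. by rewrite /axis factorl. Qed.

Definition plane_product (x : 'I_m -> R) : riemannian R (m + m) :=
  hyp_product axis (x \o factor).

Lemma factor_axis (x : 'I_m -> R) a : (x \o factor) (axis a) = (x \o factor) a.
Proof. by rewrite /= /axis factorl. Qed.

Definition lift_perm2 (s : 'I_m -> 'I_m) (a : 'I_(m + m)) : 'I_(m + m) :=
  match fintype.split a with inl i => lshift m (s i) | inr i => rshift m (s i) end.

Lemma factor_lift s a : factor (lift_perm2 s a) = s (factor a).
Proof.
by rewrite /lift_perm2 {2}/factor; case: (fintype.split a) => i; rewrite ?factorl ?factorr.
Qed.

Lemma lift_perm2_inj (s : 'I_m -> 'I_m) : injective s -> injective (lift_perm2 s).
Proof.
move=> inj_s a b; rewrite /lift_perm2 -{2}(splitK a) -{2}(splitK b).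
case: (fintype.split a) (fintype.split b) => i [] j /eqP.
- by rewrite eq_lshift => /eqP/inj_s->.
- by rewrite eq_lrshift.
- by rewrite eq_rlshift.
- by rewrite eq_rshift => /eqP/inj_s->.
Qed.

(** The position tag v + 0 is the first one when tag v = 0, and this way of
    writing it makes sense for all v. *)
Definition var_factor (v : curv_var (m + m)) : 'I_m :=
  factor (tnth (tagged v) (rshift (tag v) ord0)).

(** The frame coefficient when all factors have curvature - 1. *)
Definition var_sign (v : curv_var (m + m)) : R :=
  match v with
  | existT 0 t => curv_coef axis (fun=> 1) (t : 4.-tuple _)
  | existT _.+1 _ => 0
  end.

Lemma frame_coef_plane_product (x : 'I_m -> R) (s : 'I_m -> 'I_m)
    (p : plane_product x) (v : curv_var (m + m)) : injective s ->
  frame_coef p (hyp_frame axis (x \o factor) (lift_perm2 s) p) (tagged v) =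
  var_sign v * x (s (var_factor v)) ^+ 2.
Proof.
move=> inj_s; case: v => -[|d] t /=; last first.
  by rewrite frame_coefS ?mul0r //; [exact: axisK | exact: factor_axis].
rewrite frame_coef0; [|exact: axisK | exact: factor_axis].
rewrite /curv_coef /var_factor /= !tnth_mktuple factor_lift.
have -> : rshift 0 ord0 = ord0 :> 'I_4 by exact: val_inj.
have axisE a b : (axis (lift_perm2 s a) == axis (lift_perm2 s b)) = (axis a == axis b).
  by rewrite /axis !factor_lift !eq_lshift (inj_eq inj_s).
rewrite axisE !(inj_eq (lift_perm2_inj inj_s)); ring.
Qed.

Definition poly_value (P : curv_poly R (m + m)) (x : 'I_m -> R) : R :=
  \sum_(term <- P) term.1 *
    \prod_(v <- term.2) (var_sign v * x (var_factor v) ^+ 2).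

(** By invariance the frame E may be replaced by the adapted frame whose factors
    are permuted by s. *)
Lemma eval_plane_product P x (s : 'I_m -> 'I_m) (p : plane_product x) E :
  curvature_invariant P -> orthonormal p E -> injective s ->
  eval_curv_poly P p E = poly_value P (x \o s).
Proof.
move=> invP onE inj_s.
rewrite (invP _ _ _ (hyp_frame axis (x \o factor) (lift_perm2 s) p) onE); last first.
  by apply: hyp_frame_orthonormal; apply: lift_perm2_inj.
apply: eq_bigr => term _; congr (_ * _); apply: eq_bigr => v _.
exact: frame_coef_plane_product.
Qed.

Lemma poly_value_perm P x (s : {perm 'I_m}) :
  curvature_invariant P -> poly_value P (x \o s) = poly_value P x.
Proof.
move=> invP.
have onE : orthonormal (0 : plane_product x) (hyp_frame axis (x \o factor) id 0).
  by apply: hyp_frame_orthonormal.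
rewrite -(eval_plane_product invP onE (@perm_inj _ s)).
exact: (eval_plane_product (s := id) invP onE).
Qed.

(** The value of P is equal to its average over all permutations of the factors,
    which is computed term by term.  A term of order at most 2 k has at most k
    curvature factors, each of which counts at least 2, so that it is a monomial of
    degree at most k in the squares of the entries of x. *)
Lemma same_constant_plane_product (k : nat) (x y : 'I_m -> R) P j :
  (forall d, (d <= k)%N ->
     \sum_i (x i ^+ 2) ^+ d = \sum_i (y i ^+ 2) ^+ d) ->
  curvature_invariant P -> has_order P j -> (j <= 2 * k)%N ->
  same_constant P (plane_product x) (plane_product y).
Proof.
move=> eq_xy invP ordP lej.
suff eqP : poly_value P x = poly_value P y.
  exists (poly_value P x); split=> p E onE; [|rewrite eqP].
    exact: (eval_plane_product (s := id) invP onE).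
  exact: (eval_plane_product (s := id) invP onE).
have avg z : poly_value P z *+ #|{perm 'I_m}| = \sum_(s : {perm 'I_m}) poly_value P (z \o s).
  by under eq_bigr do rewrite poly_value_perm //; rewrite sumr_const.
have : poly_value P x *+ #|{perm 'I_m}| == poly_value P y *+ #|{perm 'I_m}|.
  rewrite !avg /poly_value exchange_big [X in _ == X]exchange_big /=; apply/eqP.
  rewrite !big_seq; apply: eq_bigr => term inP; rewrite -!mulr_sumr; congr (_ * _).
  under eq_bigr do rewrite big_split /=.
  under [RHS]eq_bigr do rewrite big_split /=.
  rewrite -!mulr_sumr; congr (_ * _).
  have E (z : 'I_m -> R) :
      \sum_(s : {perm 'I_m}) \prod_(v <- term.2) (z \o s) (var_factor v) ^+ 2 =
      \sum_(s : {perm 'I_m}) \prod_(b <- map var_factor term.2) z (s b) ^+ 2.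
    by apply: eq_bigr => s _; rewrite big_map.
  rewrite !E; apply: (eq_sum_perm_prod eq_xy); rewrite size_map.
  have := ordP _ inP; rewrite big_split /= big_const_seq count_predT iter_addn.
  move=> ordE; rewrite -(leq_pmul2l (ltn0Sn 1)) (leq_trans _ lej) //.
  by rewrite -ordE addn0 leq_addl.
rewrite -!(mulr_natr (poly_value _ _)) => /eqP; apply: mulIf.
by rewrite pnatr_eq0 -lt0n; apply/card_gt0P; exists 1%g.
Qed.

(** The plane of the i0-th factor has curvature - x i0 ^ 2; a curvature
    equivalence would map it to a plane of the same curvature, which is lower
    than all sectional curvatures of the product built from y. *)
Lemma not_curvature_equivalent_plane_product (K : R) (x y : 'I_m -> R) i0 :
  0 <= K -> (forall j, y j ^+ 2 <= K) -> K < x i0 ^+ 2 ->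
  ~ curvature_equivalent (plane_product x) (plane_product y).
Proof.
move=> K0 leK ltK /(_ 0 0)[F [_ isoF curvF]].
pose X : 'rV[R]_(m + m) := delta_mx 0 (rshift m i0).
pose Y : 'rV[R]_(m + m) := delta_mx 0 (lshift m i0).
have bound : - inner (0 : plane_product y)
      (curvature_op (0 : plane_product y) (F X) (F Y) (F Y)) (F X)
    <= K * (inner (0 : plane_product y) (F X) (F X)
            * inner (0 : plane_product y) (F Y) (F Y)).
  exact: (sectional_form_bound axisK (factor_axis y) (F X) (F Y) K0
    (fun a => leK (factor a))).
have sec : - inner (0 : plane_product x) (curvature_op (0 : plane_product x) X Y Y) X
    = x i0 ^+ 2.
  rewrite [LHS](sectional_form_delta axisK (factor_axis x)) ?eq_rlshift //.
  by rewrite /= factorr /same_factor /axis factorl factorr eqxx mulr1.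
have X1 : inner (0 : plane_product x) X X = 1 by exact: inner_delta0.
have Y1 : inner (0 : plane_product x) Y Y = 1 by exact: inner_delta0.
move: bound; rewrite -(curvF X Y Y).
move: isoF; set iy := @inner _ _ (plane_product y) 0; clearbody iy => isoF.
by rewrite !isoF sec X1 Y1 !mulr1 leNgt ltK.
Qed.

End TwoDimensionalFactors.

(** * The theorem *)

Theorem theorem11 (R : realType) (k : nat) :
  exists (n : nat) (M M' : riemannian R n),
    [/\ locally_homogeneous M,
        locally_homogeneous M',
        ~ curvature_equivalent M M' &
        forall (P : curv_poly R n) (j : nat),
          curvature_invariant P -> has_order P j -> (j <= 2 * k)%N ->
          same_constant P M M'].
Proof.
have [m [x [y [eq_xy [i0 lt_i0]]]]] := prouhet_tarry_escott R k.
(* Square roots, because a factor of parameter c has curvature - c^2. *)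
pose r (z : 'I_m -> nat) i : R := Num.sqrt (z i)%:R.
have rE z i : r z i ^+ 2 = (z i)%:R by rewrite sqr_sqrtr.
exists (m + m)%N, (plane_product (r x)), (plane_product (r y)); split.
- by apply: hyp_product_homogeneous; exact: axisK.
- by apply: hyp_product_homogeneous; exact: axisK.
- apply: (@not_curvature_equivalent_plane_product _ _ (x i0).-1%:R _ _ i0) => //.
    by move=> j; rewrite rE ler_nat -ltnS (ltn_predK (lt_i0 j)).
  by rewrite rE ltr_nat (ltn_predK (lt_i0 i0)).
- move=> P j invP ordP lej; apply: same_constant_plane_product invP ordP lej.
  move=> d led; under eq_bigr do rewrite rE; under [RHS]eq_bigr do rewrite rE.
  exact: eq_xy.
Qed.
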